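(* Let $k\geq 1$, let $\lambda\vdash k$, and let $1\leq h\leq k$. Then $f_{h,\alpha}^{\lambda}$ does not depend on $\alpha$ for $0\leq\alpha\leq k-h$; that is, $f^{\lambda}_{h,\alpha}=f^{\lambda}_{h,0}$ for all $0\le\alpha\le k-h$.
   Context: For a partition $\lambda\vdash k$, $\operatorname{SYT}(\lambda)$ is the set of standard Young tableaux of shape $\lambda$ (bijective fillings of the diagram with $1,\ldots,k$ increasing along rows and down columns). For $T\in\operatorname{SYT}(\lambda)$, $R_T(m)$ is the row (counted from the top) of the box containing $m$. For $0\le h\le k$ and $0\le\alpha\le k-h$, $\operatorname{SYT}_{h,\alpha}(\lambda)$ is the set of $T\in\operatorname{SYT}(\lambda)$ with $R_T(i+1+\alpha)>R_T(i+\alpha)$ for all $1\le i<h$, and $f^{\lambda}_{h,\alpha}=|\operatorname{SYT}_{h,\alpha}(\lambda)|$. *)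

(* Defs.v *)
From mathcomp Require Import all_boot.

Set Implicit Arguments.
Unset Strict Implicit.
Unset Printing Implicit Defensive.

Definition is_int_partition (k : nat) (la : seq nat) : bool :=
  [&& sorted geq la, all (ltn 0) la & sumn la == k].

(* Boxes are pairs (row, column), both counted from 0. *)
Definition box (la : seq nat) : finType :=
  {r : 'I_(size la) & 'I_(nth 0 la r)}.

Definition box_row (la : seq nat) (b : box la) : nat := tag b.
Definition box_col (la : seq nat) (b : box la) : nat := tagged b.

(* The value j : 'I_k stands for the entry j.+1, so entries range over 1..k. *)
Definition filling (k : nat) (la : seq nat) : finType :=
  {ffun box la -> 'I_k}.

Definition entry (k : nat) (la : seq nat) (T : filling k la) (b : box la) : nat :=
  (T b).+1.

Definition is_SYT (k : nat) (la : seq nat) (T : filling k la) : bool :=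
  [&& injectiveb T,
      [forall j : 'I_k, exists b : box la, T b == j],
      [forall b : box la, forall c : box la,
         (box_row b == box_row c) && (box_col b < box_col c)
           ==> (entry T b < entry T c)]
    & [forall b : box la, forall c : box la,
         (box_col b == box_col c) && (box_row b < box_row c)
           ==> (entry T b < entry T c)]].

Definition SYT (k : nat) (la : seq nat) : {set filling k la} :=
  [set T | is_SYT T].

(* Rows are counted from 1; the value 0 occurs only if m is not an entry of T. *)
Definition entry_row (k : nat) (la : seq nat) (T : filling k la) (m : nat) : nat :=
  if [pick b : box la | entry T b == m] is Some b then (box_row b).+1 else 0.

Definition SYT_descent (k : nat) (la : seq nat) (h alpha : nat) :
    {set filling k la} :=
  [set T in SYT k la |
     [forall i : 'I_h, (1 <= i) ==>
        (entry_row T (i + 1 + alpha) > entry_row T (i + alpha))]].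

Definition f_SYT (k : nat) (la : seq nat) (h alpha : nat) : nat :=
  #|SYT_descent k la h alpha|.

(* Main.v *)
(** Reading off the rows of the entries 1..k turns a standard tableau into a
ballot word, i.e. a walk from the empty shape to [la] adding one box at a time;
descents at [h] consecutive entries mean that the corresponding steps together
add a vertical strip of size [h].  Hence [f_SYT] counts the walks
U^alpha E_h U^(k-h-alpha), where U adds a box and E_h a vertical [h]-strip, and it
suffices that U and E_h commute.  Fix [mu] and the final shape.  If some row
gains two boxes, then each of the two orders has exactly one intermediate shape
or none.  Otherwise the added boxes form a vertical strip, made of maximal
segments of columns; the box added last must be the bottom of a segment, the
box added first the top of one, and there are as many bottoms as tops. *)

Require Import Defs.
From mathcomp Require Import all_boot.
From mathcomp Require Import zify.

Set Implicit Arguments.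
Unset Strict Implicit.
Unset Printing Implicit Defensive.

(** * Shapes with [n] rows, and exchanging a box with a vertical strip *)

Section Strips.
Variable n : nat.
Implicit Types (mu : {ffun 'I_n -> nat}) (S : {set 'I_n}) (s : seq 'I_n).
Implicit Types G : {ffun 'I_n -> nat} -> nat.

Definition part mu : bool :=
  [forall i : 'I_n, forall j : 'I_n, (j == i.+1 :> nat) ==> (mu j <= mu i)].

Lemma partP mu :
  reflect (forall i j : 'I_n, j = i.+1 :> nat -> mu j <= mu i) (part mu).
Proof.
apply: (iffP forallP) => [H i j /eqP ij | H i].
  by have /forallP/(_ j)/implyP/(_ ij) := H i.
by apply/forallP=> j; apply/implyP=> /eqP /H.
Qed.

Lemma part_le mu (i j : 'I_n) : part mu -> i <= j -> mu j <= mu i.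
Proof.
move=> /partP pmu /subnKC; move: (j - i) => m; elim: m j => [|m IHm] j ij.
  by rewrite (_ : j = i) //; apply: val_inj; rewrite /= -ij addn0.
have ltm : i + m < n by have := ltn_ord j; lia.
by apply: leq_trans (IHm (Ordinal ltm) erefl); apply: pmu; rewrite -ij addnS.
Qed.

(* [S] is a set of rows, each gaining one box. *)
Definition adds mu S : {ffun 'I_n -> nat} := [ffun i => mu i + (i \in S)].

Lemma adds_partP mu S :
  reflect (forall i j : 'I_n, j = i.+1 :> nat ->
             mu j + (j \in S) <= mu i + (i \in S)) (part (adds mu S)).
Proof. by apply: (iffP (partP _)) => H i j /H; rewrite !ffunE. Qed.

Lemma addsAC mu S S' : adds (adds mu S) S' = adds (adds mu S') S.
Proof. by apply/ffunP=> i; rewrite !ffunE addnAC. Qed.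

Lemma adds_set1U mu S x :
  x \notin S -> adds (adds mu S) [set x] = adds mu (x |: S).
Proof.
move=> xS; apply/ffunP=> i; rewrite !ffunE !inE.
by case: eqVneq => [->|_] /=; rewrite ?(negPf xS); lia.
Qed.

(** Both sides hold. As row [x] ends up with two more boxes, the row above it is already longer than
    [mu x]; and a single new box in row [x] leaves room for the row below, which gains at most
    one. *)
Lemma double_step_part mu S x : part mu -> x \in S ->
    part (adds (adds mu S) [set x]) ->
  part (adds mu S) = part (adds mu [set x]).
Proof.
move=> /partP pmu xS /adds_partP pSx.
apply/adds_partP/adds_partP => H i j ij; have := pmu i j ij;
  have := pSx i j ij; have := H i j ij; rewrite !ffunE !inE.
  case: (eqVneq j x) => [->|jx]; case: (eqVneq i x) => [ix|ix]; rewrite ?xS /=; lia.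
case: (eqVneq j x) => [->|jx]; case: (eqVneq i x) => [->|ix]; rewrite ?xS /=; lia.
Qed.

(* Both sides are [#|S|] minus the number of pairs of vertically adjacent boxes. *)
Lemma card_corners mu S : part mu -> part (adds mu S) ->
  #|[set x in S | part (adds mu (S :\ x))]| =
  #|[set y in S | part (adds mu [set y])]|.
Proof.
move=> /partP pmu /adds_partP pS.
(* A pair in [Adj] is two added boxes in the same column and consecutive rows. First components are
   the rows that are not bottoms of a segment, second components those that are not tops. *)
pose Adj := [set p : 'I_n * 'I_n | [&& p.1 \in S, p.2 \in S,
   p.2 == p.1.+1 :> nat & mu p.1 == mu p.2]].
have -> : [set x in S | part (adds mu (S :\ x))] = S :\: (fst @: Adj).
  apply/setP=> x; rewrite !inE andbC; case xS: (x \in S); rewrite ?andbF //= !andbT.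
  apply/adds_partP/negP => [H /imsetP[[i j]] | H i j ij].
    rewrite inE /= => /and4P[iS jS /eqP ij /eqP mij] xi; subst x.
    move: (H i j ij); rewrite !inE iS jS eqxx (_ : j == i = false) /=; first lia.
    by apply/eqP=> e; move: ij; rewrite e; lia.
  have := pS i j ij; have := pmu i j ij; rewrite !inE.
  case: (eqVneq i x) => [ix|ix]; case: (eqVneq j x) => [jx|jx] /=; try lia.
  subst i; rewrite xS; case jS: (j \in S); last lia.
  case: (eqVneq (mu x) (mu j)) => [mxj|]; last lia.
  by case: H; apply/imsetP; exists (x, j); rewrite // inE /= xS jS ij mxj !eqxx.
have -> : [set y in S | part (adds mu [set y])] = S :\: (snd @: Adj).
  apply/setP=> y; rewrite !inE andbC; case yS: (y \in S); rewrite ?andbF //= !andbT.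
  apply/adds_partP/negP => [H /imsetP[[i j]] | H i j ij].
    rewrite inE /= => /and4P[iS jS /eqP ij /eqP mij] yj; subst y.
    move: (H i j ij); rewrite !inE eqxx (_ : i == j = false) /=; first lia.
    by apply/eqP=> e; move: ij; rewrite e; lia.
  have := pS i j ij; have := pmu i j ij; rewrite !inE.
  case: (eqVneq i y) => [iy|iy]; case: (eqVneq j y) => [jy|jy] /=; try lia.
  subst j; rewrite yS; case iS: (i \in S); last lia.
  case: (eqVneq (mu i) (mu y)) => [miy|]; last lia.
  by case: H; apply/imsetP; exists (i, y); rewrite // inE /= yS iS ij miy !eqxx.
have inj1 : {in Adj &, injective fst}.
  move=> [i j] [i' j']; rewrite !inE /= => /and4P[_ _ /eqP e _].
  by move=> /and4P[_ _ /eqP e' _] ii'; congr pair => //; apply: val_inj; rewrite /= e e' ii'.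
have inj2 : {in Adj &, injective snd}.
  move=> [i j] [i' j']; rewrite !inE /= => /and4P[_ _ /eqP e _].
  move=> /and4P[_ _ /eqP e' _] jj'; congr pair => //; apply: val_inj => /=.
  by move: e; rewrite jj' e' => -[].
have s1 : fst @: Adj \subset S.
  by apply/subsetP=> _ /imsetP[[i j] + ->]; rewrite inE => /and4P[].
have s2 : snd @: Adj \subset S.
  by apply/subsetP=> _ /imsetP[[i j] + ->]; rewrite inE => /and4P[].
by rewrite !cardsDS // !card_in_imset.
Qed.

(** The operator U acts on weights [G] of final shapes, so a composite reads in the order of the
    walk: the outermost operator is the first step. *)
Definition add_box G mu : nat :=
  \sum_(x | part (adds mu [set x])) G (adds mu [set x]).

Definition add_strip h G mu : nat :=
  \sum_(S : {set 'I_n} | (#|S| == h) && part (adds mu S)) G (adds mu S).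

(** A pair with [x] outside [S] amounts to the set [x |: S] with the element [x] marked; since [F]
    sees only the set, it remains to count the marks. *)
Lemma sum_notin_set (P : {set 'I_n} -> 'I_n -> bool) (F : {set 'I_n} -> nat) :
  \sum_(p : {set 'I_n} * 'I_n | P p.1 p.2 && (p.2 \notin p.1)) F (p.2 |: p.1) =
  \sum_(S : {set 'I_n}) #|[set x in S | P (S :\ x) x]| * F S.
Proof.
under [RHS]eq_bigr do rewrite -sum_nat_const.
rewrite pair_big_dep /=.
rewrite (reindex_onto (fun p => (p.1 :\ p.2, p.2)) (fun p => (p.2 |: p.1, p.2))) /=; last first.
  by move=> [S x] /= /andP[_ xS]; rewrite setU1K.
apply: eq_big => [[S x]|[S x]] /=.
  rewrite !inE eqxx /= andbT andbC; congr (_ && _).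
  apply/eqP/idP => [[<-]|xS]; first by rewrite setU11.
  by rewrite setD1K.
by move=> /andP[_ /eqP[->]].
Qed.

Lemma sum_mem_set (P : {set 'I_n} -> 'I_n -> bool) (F : {set 'I_n} -> 'I_n -> nat) :
  \sum_S \sum_(x | P S x) F S x =
  \sum_(p : {set 'I_n} * 'I_n | P p.1 p.2 && (p.2 \in p.1)) F p.1 p.2 +
  \sum_(p : {set 'I_n} * 'I_n | P p.1 p.2 && (p.2 \notin p.1)) F p.1 p.2.
Proof. by rewrite pair_big_dep (bigID (fun p : {set 'I_n} * 'I_n => p.2 \in p.1)). Qed.

(** Pairs with [x] in [S] match one to one by [double_step_part]. For the others the final shape
    depends only on [x |: S], and [card_corners] equates the choices of the last box with those of
    the first. *)
Lemma add_strip_box h G mu : part mu ->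
  add_strip h (add_box G) mu = add_box (add_strip h G) mu.
Proof.
move=> pmu.
pose F S x := G (adds (adds mu S) [set x]).
(* In [P] the strip comes first, in [Q] the box; they differ only in which intermediate shape must
   be a partition. *)
pose P S x := [&& #|S| == h, part (adds mu S) & part (adds (adds mu S) [set x])].
pose Q S x := [&& #|S| == h, part (adds mu [set x]) & part (adds (adds mu S) [set x])].
have -> : add_strip h (add_box G) mu = \sum_S \sum_(x | P S x) F S x.
  rewrite /add_strip /add_box big_mkcond; apply: eq_bigr => S _; rewrite /P.
  by case: (#|S| == h) => /=; [case: part|]; rewrite //= big_pred0_eq.
have -> : add_box (add_strip h G) mu = \sum_S \sum_(x | Q S x) F S x.
  rewrite [RHS](exchange_big_dep predT) //= /add_strip /add_box big_mkcond; apply: eq_bigr => x _; rewrite /Q.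
  case: part; last by rewrite big_pred0 // => S; rewrite andbF.
  by apply: eq_big => S; rewrite addsAC // => _; rewrite /F addsAC.
rewrite !sum_mem_set; congr (_ + _).
  apply: eq_bigl => -[S x] /=; case xS: (x \in S); rewrite ?andbF // !andbT.
  rewrite /P /Q; case pSx: (part (adds (adds mu S) [set x])); rewrite ?andbF // !andbT.
  by rewrite (double_step_part pmu xS pSx).
have FE (R : {set 'I_n} -> 'I_n -> bool) :
    \sum_(p : {set 'I_n} * 'I_n | R p.1 p.2 && (p.2 \notin p.1)) F p.1 p.2 =
    \sum_(S : {set 'I_n}) #|[set x in S | R (S :\ x) x]| * G (adds mu S).
  rewrite -(sum_notin_set R (fun S => G (adds mu S))); apply: eq_bigr => -[S x] /= /andP[_ xS].
  by rewrite /F adds_set1U.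
rewrite !FE; apply: eq_bigr => S _; congr (_ * _).
(* From here [S] is the enlarged set, of size [h.+1]; only the condition [R] on the marked element
   distinguishes the two counts. *)
have RE (R : 'I_n -> bool) (T : {set 'I_n} -> 'I_n -> bool) :
    (forall x, x \in S -> T (S :\ x) x = [&& #|S| == h.+1, part (adds mu S) & R x]) ->
    #|[set x in S | T (S :\ x) x]| =
    if (#|S| == h.+1) && part (adds mu S) then #|[set x in S | R x]| else 0.
  move=> H; case: ifP => c.
    apply: eq_card => x; rewrite !inE; case xS: (x \in S) => //=.
    by rewrite H //; case/andP: c => -> ->.
  apply: eq_card0 => x; rewrite !inE; case xS: (x \in S) => //=.
  by rewrite H // andbA c.
rewrite (RE (fun x => part (adds mu (S :\ x))) P); last first.
  move=> x xS; rewrite /P adds_set1U ?setD11 // setD1K // (cardsD1 x S) xS eqSS.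
  by congr (_ && _); rewrite andbC.
rewrite (RE (fun x => part (adds mu [set x])) Q); last first.
  move=> x xS; rewrite /Q adds_set1U ?setD11 // setD1K // (cardsD1 x S) xS eqSS.
  by congr (_ && _); rewrite andbC.
by case: ifP => // /andP[_ pS]; apply: card_corners.
Qed.

(** * Words of rows as walks between shapes *)

Definition addw mu s : {ffun 'I_n -> nat} := [ffun i => mu i + count_mem i s].

(** The shape is tested after each step but not at the start, whence the assumption [part mu] in
    [ballotP], where the empty prefix counts. *)
Fixpoint ballot mu s : bool :=
  if s is r :: s' then part (adds mu [set r]) && ballot (adds mu [set r]) s'
  else true.

Definition strict s : bool := sorted (fun i j : 'I_n => i < j) s.

Lemma addw_nil mu : addw mu [::] = mu.
Proof. by apply/ffunP=> i; rewrite ffunE addn0. Qed.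

Lemma addw_cons mu r s : addw mu (r :: s) = addw (adds mu [set r]) s.
Proof. by apply/ffunP=> i; rewrite !ffunE /= inE eq_sym addnA. Qed.

Lemma addw_cat mu s1 s2 : addw mu (s1 ++ s2) = addw (addw mu s1) s2.
Proof. by apply/ffunP=> i; rewrite !ffunE count_cat addnA. Qed.

Lemma ballot_cat mu s1 s2 :
  ballot mu (s1 ++ s2) = ballot mu s1 && ballot (addw mu s1) s2.
Proof.
elim: s1 mu => [|r s1 IHs] mu /=; first by rewrite addw_nil.
by rewrite IHs addw_cons andbA.
Qed.

Lemma ballotP mu s : part mu ->
  reflect (forall p, part (addw mu (take p s))) (ballot mu s).
Proof.
elim: s mu => [|r s IHs] mu pmu /=.
  by apply: ReflectT => p; rewrite addw_nil.
apply: (iffP andP) => [[pr /IHs bs] [|p]|H].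
- by rewrite addw_nil.
- by rewrite addw_cons; apply: bs.
have pr : part (adds mu [set r]) by have := H 1; rewrite /= take0 addw_cons addw_nil.
by split=> //; apply/IHs => // p; have := H p.+1; rewrite addw_cons.
Qed.

Lemma ballot_part mu s : part mu -> ballot mu s -> part (addw mu s).
Proof. by move=> pmu /(ballotP s pmu)/(_ (size s)); rewrite take_size. Qed.

Lemma sum_tuple_cat a b (P : pred (seq 'I_n)) (F : seq 'I_n -> nat) :
  \sum_(t : (a + b).-tuple 'I_n | P t) F t =
  \sum_(u : a.-tuple 'I_n) \sum_(v : b.-tuple 'I_n | P (u ++ v)) F (u ++ v).
Proof.
have Ha (t : (a + b).-tuple 'I_n) : size (take a t) == a.
  by rewrite size_takel // size_tuple leq_addr.
have Hb (t : (a + b).-tuple 'I_n) : size (drop a t) == b.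
  by rewrite size_drop size_tuple addKn.
rewrite pair_big_dep /=.
rewrite (reindex (fun p : a.-tuple 'I_n * b.-tuple 'I_n => cat_tuple p.1 p.2)) //=.
exists (fun t => (Tuple (Ha t), Tuple (Hb t))) => [[u v] _|t _] /=.
  by congr pair; apply: val_inj => /=;
    rewrite (take_size_cat, drop_size_cat) ?size_tuple.
by apply: val_inj; rewrite /= cat_take_drop.
Qed.

Lemma sum_tuple_cons m (P : pred (seq 'I_n)) (F : seq 'I_n -> nat) :
  \sum_(t : m.+1.-tuple 'I_n | P t) F t =
  \sum_x \sum_(t : m.-tuple 'I_n | P (x :: t)) F (x :: t).
Proof.
rewrite pair_big_dep /=.
rewrite (reindex (fun p : 'I_n * m.-tuple 'I_n => cons_tuple p.1 p.2)) //=.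
exists (fun t => (thead t, behead_tuple t)) => [[x t] _|t _] /=.
  by congr pair; apply: val_inj.
by rewrite [RHS]tuple_eta; apply: val_inj.
Qed.

Lemma sum_tuple_nil (P : pred (seq 'I_n)) (F : seq 'I_n -> nat) :
  P [::] -> \sum_(t : 0.-tuple 'I_n | P t) F t = F [::].
Proof.
move=> P0; rewrite (big_pred1 [tuple]) // => t.
by rewrite [t]tuple0 /= P0 eqxx.
Qed.

Lemma walk_box m G mu :
  \sum_(t : m.-tuple 'I_n | ballot mu t) G (addw mu t) = iter m add_box G mu.
Proof.
elim: m mu => [|m IHm] mu.
  by rewrite (@sum_tuple_nil (ballot mu) (fun s => G (addw mu s))) ?addw_nil.
rewrite (sum_tuple_cons m (ballot mu) (fun s => G (addw mu s))) iterS /add_box [RHS]big_mkcond /=.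
apply: eq_bigr => x _; rewrite /= -IHm.
case: part => /=; last by rewrite big_pred0_eq.
by apply: eq_bigr => t _; rewrite addw_cons.
Qed.

(** An increasing word adds boxes from top to bottom, so no box has to wait for one above it and
    only the final shape matters. *)
Lemma ballot_strict mu s : part mu -> strict s -> ballot mu s = part (addw mu s).
Proof.
move=> pmu ss; apply/idP/idP => [|ps]; first exact: ballot_part.
elim: s mu pmu ss ps => [|x s IHs] //= mu pmu.
rewrite /strict /= path_sortedE => [/andP[/allP xs ss]|? ? ?]; last exact: ltn_trans.
rewrite addw_cons => ps.
(* The row just above [x] is not touched by the later letters, all larger than [x], so the
   inequality there is inherited from the final shape. *)
have px : part (adds mu [set x]).
  apply/adds_partP => i j ij; move/partP: pmu => /(_ i j ij).
  move/partP: ps => /(_ i j ij); rewrite !ffunE !inE.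
  case: (eqVneq j x) => [jx|jx] /=; last lia.
  have -> : i == x = false by apply/eqP=> ix; subst; lia.
  have /count_memPn -> : i \notin s by apply/negP => /xs; rewrite -jx ij; lia.
  lia.
by rewrite px IHs.
Qed.

(** A strict word is the increasing enumeration of its set of letters, so strict words of length [h]
    correspond to sets of size [h]. *)
Lemma walk_strip h G mu : part mu ->
  \sum_(t : h.-tuple 'I_n | ballot mu t && strict t) G (addw mu t) =
  add_strip h G mu.
Proof.
move=> pmu; pose tr : transitive (fun i j : 'I_n => i < j) := fun _ _ _ => @ltn_trans _ _ _.
have ir : irreflexive (fun i j : 'I_n => i < j) by move=> i; apply: ltnn.
have sE S : strict (enum S).
  rewrite /strict {1}/enum_mem -enumT; apply: sorted_filter => //.
  have : sorted ltn (map (@nat_of_ord n) (enum 'I_n)).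
    by rewrite val_enum_ord iota_ltn_sorted.
  by rewrite sorted_map.
have aw s : strict s -> addw mu s = adds mu [set i in s].
  move=> ss; apply/ffunP=> i; rewrite !ffunE !inE count_uniq_mem //.
  exact: sorted_uniq ss.
have eE s : strict s -> enum [set i in s] = s.
  move=> ss; apply: (irr_sorted_eq tr ir (sE _) ss) => i.
  by rewrite mem_enum inE.
rewrite /add_strip (reindex_omap (fun t : h.-tuple 'I_n => [set i in t])
  (fun S => insub (enum S))) /=; last first.
  move=> S /andP[/eqP cS _]; case: insubP => [t _ tE|]; last by rewrite -cardE cS eqxx.
  by rewrite /=; congr Some; apply/setP=> i; rewrite inE -[RHS]mem_enum -tE.
apply: eq_big => [t|t /andP[_ st]]; last by rewrite aw.
(* The partial inverse returns only increasing enumerations, so it never returns a word that is not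
   strict. *)
case st: (strict t); last first.
  rewrite andbF; apply/esym/negbTE; rewrite negb_and; apply/orP; right.
  apply/eqP; case: insubP => // u _ uE [ut].
  by move: (sE [set i in t]); rewrite -uE ut st.
rewrite ballot_strict // -aw // andbT cardE eE // size_tuple eqxx /=.
by rewrite valK eqxx andbT.
Qed.

(** This lets [add_strip_box], which holds at partitions only, be applied underneath [add_box]. *)
Lemma add_box_ext F G mu : (forall nu, part nu -> F nu = G nu) ->
  add_box F mu = add_box G mu.
Proof. by move=> FG; apply: eq_bigr => x /FG. Qed.

Lemma add_strip_iter h m G mu : part mu ->
  add_strip h (iter m add_box G) mu = iter m add_box (add_strip h G) mu.
Proof.
elim: m mu => //= m IHm mu pmu.
by rewrite add_strip_box //; apply: add_box_ext.
Qed.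

Lemma walk_box_strip a h b G mu : part mu ->
  \sum_(t : (a + (h + b)).-tuple 'I_n |
         ballot mu t && strict (take h (drop a t))) G (addw mu t) =
  iter a add_box (add_strip h (iter b add_box G)) mu.
Proof.
elim: a mu => [|a IHa] mu pmu.
  rewrite (@sum_tuple_cat h b (fun t => ballot mu t && strict (take h (drop 0 t)))
             (fun t => G (addw mu t))) /= -walk_strip //.
  rewrite [RHS]big_mkcond /=; apply: eq_bigr => u _.
  under eq_bigl do rewrite drop0 take_size_cat ?size_tuple // ballot_cat.
  case: ifP => [/andP[-> ->]|]; last first.
    by move=> bs; rewrite big_pred0 // => v; rewrite andbAC bs.
  by rewrite -walk_box; apply: eq_big => v; rewrite ?andbT // => _; rewrite addw_cat.
rewrite (sum_tuple_cons _ (fun t => ballot mu t && strict (take h (drop a.+1 t)))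
           (fun t => G (addw mu t))).
rewrite iterS /add_box [RHS]big_mkcond /=; apply: eq_bigr => x _.
case: ifP => [px|_]; last by rewrite big_pred0.
by rewrite -IHa //; apply: eq_bigr => t _; rewrite addw_cons.
Qed.

(** The right-hand side involves [a] and [b] only through [a + b]: this is the independence of the
    position of the strip. *)
Lemma walk_strip_shift a h b G mu : part mu ->
  \sum_(t : (a + (h + b)).-tuple 'I_n |
         ballot mu t && strict (take h (drop a t))) G (addw mu t) =
  add_strip h (iter (a + b) add_box G) mu.
Proof. by move=> pmu; rewrite walk_box_strip // -add_strip_iter // iterD. Qed.

End Strips.

(** * Counting letters in prefixes of a word *)

Lemma card_ord_lt m c : c <= m -> #|[set i : 'I_m | i < c]| = c.
Proof. by move=> cm; rewrite cardsE -sum1_card (big_ord_narrow cm) sum1_card card_ord. Qed.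

Section TupleRank.
Variables (A : eqType) (k : nat) (w : k.-tuple A).

Lemma count_take_succ (r : A) (i : 'I_k) :
  count_mem r (take i.+1 w) = count_mem r (take i w) + (tnth w i == r).
Proof.
by rewrite (take_nth (tnth w i)) ?size_tuple // -cats1 count_cat /= addn0 -tnth_nth.
Qed.

Lemma count_take_mono (r : A) i j :
  i <= j -> count_mem r (take i w) <= count_mem r (take j w).
Proof.
move=> ij; rewrite -(cat_take_drop i (take j w)) take_takel //.
by rewrite count_cat leq_addr.
Qed.

Lemma count_take_lt (i : 'I_k) j : i < j ->
  count_mem (tnth w i) (take i w) < count_mem (tnth w i) (take j w).
Proof.
by move=> ij; apply: leq_trans (count_take_mono _ ij); rewrite count_take_succ eqxx addn1.
Qed.

(** A position is determined by its letter and the number of earlier occurrences of it; for tableaux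
    these are the row and column of a box. *)
Lemma count_take_inj (i j : 'I_k) : tnth w i = tnth w j ->
  count_mem (tnth w i) (take i w) = count_mem (tnth w j) (take j w) -> i = j.
Proof.
move=> wij cij; apply: val_inj; case: (ltngtP i j) => // lt.
  by have := count_take_lt lt; rewrite cij wij ltnn.
by have := count_take_lt lt; rewrite -cij wij ltnn.
Qed.

Lemma count_take_card (r : A) j :
  count_mem r (take j w) = #|[set i : 'I_k | (i < j) && (tnth w i == r)]|.
Proof.
elim: j => [|j IHj]; first by rewrite take0 eq_card0 // => i; rewrite inE.
case: (ltnP j k) => [jk|kj].
  rewrite (count_take_succ r (Ordinal jk)) /= IHj.
  rewrite (cardsD1 (Ordinal jk) [set i : 'I_k | (i < j.+1) && _]) inE ltnS leqnn /= addnC.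
  congr (_ + _); apply: eq_card => i; rewrite !inE -(inj_eq val_inj) /= ltnS.
  by case: ltngtP.
rewrite take_oversize ?size_tuple; last exact: leqW.
rewrite -(take_oversize (n := j) (s := w)) ?size_tuple // IHj.
by apply: eq_card => i; rewrite !inE; have := ltn_ord i; case: ltnP; case: ltnP => //; lia.
Qed.
End TupleRank.

(** * Standard tableaux as ballot words *)

Section Words.
Variables (k : nat) (la : seq nat) (d : 'I_(size la)).
Hypothesis la_part : is_int_partition k la.
Implicit Type T : filling k la.

Definition Box (r : 'I_(size la)) (c : 'I_(nth 0 la r)) : box la :=
  Tagged (fun r : 'I_(size la) => 'I_(nth 0 la r)) c.

(* The default [d] is never used when [T] is a standard tableau. *)
Definition row_word T : k.-tuple 'I_(size la) :=
  [tuple if [pick b | T b == j] is Some b then tag b else d | j < k].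

Definition empty : {ffun 'I_(size la) -> nat} := [ffun => 0].
Definition shape : {ffun 'I_(size la) -> nat} := [ffun r : 'I_(size la) => nth 0 la r].

Lemma shape_le (i j : 'I_(size la)) : i <= j -> nth 0 la j <= nth 0 la i.
Proof.
case/and3P: la_part => sla _ _ ij.
have tr : transitive geq by move=> x y z /= xy yz; apply: leq_trans yz xy.
have rf : reflexive geq by move=> x; apply: leqnn.
  exact: (sorted_leq_nth tr rf 0 sla i j (ltn_ord i) (ltn_ord j) ij).
Qed.

Lemma card_box : #|{: box la}| = k.
Proof.
case/and3P: la_part => _ _ /eqP <-.
rewrite card_tagged !sumnE big_map big_enum /= (big_nth 0) big_mkord.
by apply: eq_bigr => i _; rewrite card_ord.
Qed.

Lemma row_wordE T b : is_SYT T -> tnth (row_word T) (T b) = tag b.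
Proof.
case/and4P=> /injectiveP Tinj _ _ _; rewrite tnth_mktuple.
by case: pickP => [b' /eqP /Tinj -> //|/(_ b)]; rewrite eqxx.
Qed.

Lemma row_lt T (r : 'I_(size la)) (c c' : 'I_(nth 0 la r)) : is_SYT T ->
  (T (Box c) < T (Box c')) = (c < c').
Proof.
case/and4P=> _ _ /forallP H _.
have mono (x y : 'I_(nth 0 la r)) : x < y -> T (Box x) < T (Box y).
  by have /forallP/(_ (Box y))/implyP := H (Box x); rewrite /box_row /box_col /= eqxx; apply.
case: (ltngtP c c') => [/mono //|/mono lt|/val_inj ->]; last by rewrite ltnn.
by apply/negbTE; rewrite -leqNgt ltnW.
Qed.

Lemma count_row_word T (r : 'I_(size la)) j : is_SYT T ->
  count_mem r (take j (row_word T)) = #|[set c : 'I_(nth 0 la r) | T (Box c) < j]|.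
Proof.
move=> sT; have /and4P[/injectiveP Tinj /forallP Tsurj _ _] := sT.
have inj : injective (fun c : 'I_(nth 0 la r) => T (Box c)).
  move=> c c' /Tinj cc; apply: val_inj.
  by have := congr1 (@box_col la) cc.
rewrite count_take_card -(card_imset _ inj); apply: eq_card => i; rewrite !inE.
apply/andP/imsetP => [[ij /eqP wi]|[c]].
  have /existsP[b /eqP Tb] := Tsurj i.
  move: wi; rewrite -Tb row_wordE //; case: b Tb => r' c /= Tb rr; subst r'.
  by exists c; rewrite // inE /Box /Tagged Tb.
by rewrite inE => cj ->; rewrite cj row_wordE.
Qed.

(** Entries increase along a row, so the boxes of that row with smaller entries are those to the
    left. *)
Lemma count_row_word_col T b : is_SYT T ->
  count_mem (tag b) (take (T b) (row_word T)) = box_col b.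
Proof.
move=> sT; rewrite count_row_word //; case: b => r c /=.
rewrite -[RHS](card_ord_lt (ltnW (ltn_ord c))); apply: eq_card => c'.
by rewrite !inE -(row_lt c' c sT).
Qed.

Lemma row_word_inj : {in [pred T | is_SYT T] &, injective row_word}.
Proof.
move=> T T' sT sT' ww; rewrite !inE in sT sT'; apply/ffunP=> b.
apply: (count_take_inj (w := row_word T)); first by rewrite row_wordE // ww row_wordE.
by rewrite row_wordE // count_row_word_col // ww row_wordE // count_row_word_col.
Qed.

Lemma row_word_content T : is_SYT T -> addw empty (row_word T) = shape.
Proof.
move=> sT; apply/ffunP=> r; rewrite !ffunE add0n -[X in count _ X](take_oversize (n := k)) ?size_tuple //.
rewrite count_row_word // -[RHS]card_ord; apply: eq_card => c.
by rewrite !inE ltn_ord.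
Qed.

Lemma part_empty : part empty.
Proof. by apply/partP=> i j _; rewrite !ffunE. Qed.

(** Moving each box of row [j] up to row [i] in its column decreases its entry, so the boxes filled
    so far in row [j] inject into those of row [i]. *)
Lemma row_word_ballot T : is_SYT T -> ballot empty (row_word T).
Proof.
move=> sT; apply/ballotP; first exact: part_empty.
move=> p; apply/partP=> i j ij; rewrite !ffunE !add0n !count_row_word //.
have le_ij : nth 0 la j <= nth 0 la i by apply: shape_le; rewrite ij.
have inj : injective (widen_ord le_ij).
  by move=> x y /(congr1 val) /= xy; apply: val_inj.
rewrite -(card_imset _ inj); apply: subset_leq_card; apply/subsetP=> _ /imsetP[c + ->].
rewrite !inE; apply: leq_ltn_trans; apply: ltnW.
case/and4P: sT => _ _ _ /forallP/(_ (Box (widen_ord le_ij c))) /forallP/(_ (Box c)) /implyP.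
by apply; rewrite /box_col /box_row /= eqxx ij ltnSn.
Qed.

(** Letter [j] is sent to the box in its row whose column is the number of earlier occurrences. This
    map [beta] is injective between sets of size [k], and its inverse is the tableau. *)
Lemma word_SYT (w : k.-tuple 'I_(size la)) :
  ballot empty w -> addw empty w = shape -> exists2 T, is_SYT T & row_word T = w.
Proof.
move=> /(ballotP _ part_empty) bw cw.
have cr r : count_mem r w = nth 0 la r.
  by have /ffunP/(_ r) := cw; rewrite !ffunE.
have lt j : count_mem (tnth w j) (take j w) < nth 0 la (tnth w j).
  rewrite -cr -[X in _ < count _ X](take_oversize (n := k)) ?size_tuple //.
  exact: count_take_lt.
pose beta j := Box (Ordinal (lt j)).
have beta_inj : injective beta.
  move=> i j bij; apply: (count_take_inj (w := w)); first by have := congr1 tag bij.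
  by have := congr1 (@box_col la) bij.
have [g gK Kg] : bijective beta.
  by apply: inj_card_bij => //; rewrite card_ord -card_box.
have wg b : tnth w (g b) = tag b by rewrite -{2}(Kg b).
have cg b : count_mem (tag b) (take (g b) w) = box_col b.
  by rewrite -{3}(Kg b) -wg.
pose T : filling k la := [ffun b => g b].
have sT : is_SYT T.
  apply/and4P; split.
  - by apply/injectiveP=> b b'; rewrite !ffunE => /(can_inj Kg).
  - by apply/forallP=> j; apply/existsP; exists (beta j); rewrite ffunE gK.
  - apply/forallP=> b; apply/forallP=> b'; apply/implyP=> /andP[/eqP /val_inj rr cc].
    rewrite /entry !ffunE ltnS ltnNge; apply/negP=> gg.
    have := count_take_mono w (tag b) gg.
    by rewrite cg {1}rr cg leqNgt cc.
  - apply/forallP=> b; apply/forallP=> b'; apply/implyP=> /andP[/eqP cc rr].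
    rewrite /entry !ffunE ltnS.
    (* Just after [b'] is filled, its row holds one box more than the common column index; by the
       ballot condition so does the row of [b], hence [b] is already filled. *)
    have := part_le (bw (g b').+1) (ltnW rr).
    rewrite !ffunE !add0n count_take_succ wg eqxx cg addn1 -cc -(cg b) => lt_cnt.
    rewrite ltn_neqAle; apply/andP; split.
      apply/eqP=> /val_inj gg; have tt : tag b = tag b' by rewrite -!wg gg.
      by move: rr; rewrite /box_row tt ltnn.
    rewrite leqNgt; apply/negP => gg.
    by have := leq_trans lt_cnt (count_take_mono w (tag b) gg); rewrite ltnn.
exists T => //; apply: eq_from_tnth => j.
have -> : j = T (beta j) by rewrite ffunE gK.
by rewrite row_wordE // ffunE gK.
Qed.

Lemma entry_rowE T m : is_SYT T -> m < k ->
  entry_row T m.+1 = (nth d (row_word T) m).+1.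
Proof.
move=> /and4P[_ /forallP Tsurj _ _] mk; rewrite /entry_row.
rewrite -[m in RHS]/(val (Ordinal mk)) -tnth_nth tnth_mktuple.
have -> : [pick b : box la | entry T b == m.+1] = [pick b | T b == Ordinal mk].
  by apply: eq_pick => b; rewrite /entry eqSS -(inj_eq val_inj).
case: pickP => // nob; have /existsP[b] := Tsurj (Ordinal mk).
by rewrite nob.
Qed.

(** Entries count from 1 and letters from 0: for [1 <= i], entry [i + alpha] is the letter of index
    [i - 1] in the block, so there are [h - 1] comparisons on both sides. *)
Lemma descent_strict T h alpha : is_SYT T -> alpha + h <= k ->
  [forall i : 'I_h, (1 <= i) ==>
     (entry_row T (i + 1 + alpha) > entry_row T (i + alpha))] =
  strict (take h (drop alpha (row_word T))).
Proof.
move=> sT hk.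
have sz : size (take h (drop alpha (row_word T))) = h.
  by rewrite size_takel // size_drop size_tuple; lia.
have rowE m : m < k -> entry_row T m.+1 = (nth d (row_word T) m).+1.
  exact: entry_rowE.
move: (row_word T : seq _) sz rowE => w sz rowE.
apply/forallP/(sortedP d); rewrite sz => H i.
  move=> ih; have := H (Ordinal ih) => /= {H}.
  rewrite addSn addn1 addSn !rowE ?nth_take ?nth_drop ?(addnC alpha) //; lia.
apply/implyP; case: i => -[|i] //= ih _; have := H i ih.
by rewrite addn1 !addSn !rowE ?nth_take ?nth_drop ?(addnC alpha) //; lia.
Qed.

(** [row_word] is a bijection onto the ballot words of content [la]. The final shape enters as a 0-1
    weight, the form in which the walk lemmas take it. *)
Lemma f_SYT_words h alpha : alpha + h <= k ->
  f_SYT k la h alpha =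
  \sum_(t : k.-tuple 'I_(size la) |
      ballot empty t && strict (take h (drop alpha t))) (addw empty t == shape).
Proof.
move=> hk; rewrite /f_SYT -big_mkcondr sum1dep_card.
rewrite -(card_in_imset (f := row_word)); last first.
  by move=> T T'; rewrite !inE => /andP[sT _] /andP[sT' _]; apply: row_word_inj.
apply: eq_card => w; rewrite [RHS]inE; apply/imsetP/andP.
  case=> T; rewrite !inE => /andP[sT dT] ->.
  by rewrite row_word_ballot // -descent_strict // dT row_word_content.
move=> [/andP[bw sw] /eqP cw]; have [T sT Tw] := word_SYT bw cw.
by exists T => //; rewrite !inE sT descent_strict // Tw.
Qed.
End Words.

Theorem theorem4p9 (k : nat) (la : seq nat) (h : nat) :
  1 <= k -> is_int_partition k la -> 1 <= h <= k ->
  forall alpha : nat, alpha <= k - h ->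
    f_SYT k la h alpha = f_SYT k la h 0.
Proof.
move=> k_gt0 la_part /andP[_ hk] alpha ak.
(* Since [k] is positive, [la] has a row, which provides the default letter of [row_word]. *)
have d : 'I_(size la).
  apply: Ordinal (_ : 0 < _); case: la la_part => // /and3P[_ _ /eqP /= k0].
  by rewrite -k0 in k_gt0.
(* The right-hand side is free of [b], so it serves for both [alpha] and 0. *)
have words b : b <= k - h -> f_SYT k la h b =
    add_strip h (iter (k - h) (@add_box _) (fun mu => mu == shape la)) (empty la).
  move=> bk; rewrite (f_SYT_words d) //; last lia.
  have [c kE] : exists c, k = b + (h + c) by exists (k - h - b); lia.
  have -> : k - h = b + c by lia.
  rewrite -walk_strip_shift; last exact: part_empty.
  (* The substitution gives the tuple length the syntactic form [b + (h + c)]. *)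
  by subst k.
by rewrite !words.
Qed.
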